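(* Let $0<\beta<1$, let $b$ be a locally integrable (real-valued) function on $\mathbb{R}^n$ and let $\mu\in A_1$. For $1\le s<\infty$ consider the condition $$(\ast)_s\qquad \sup_Q\frac1{\mu(Q)^{\beta/n}}\left(\frac1{\mu(Q)}\int_Q|b(x)-M_Q(b)(x)|^s\mu(x)^{1-s}\,dx\right)^{1/s}\le C\quad\text{for some finite constant } C,$$ where the supremum is taken over all cubes $Q\subset\mathbb{R}^n$. Then the following assertions are equivalent: (1) $b\in Lip_{\beta,\mu}$ and $b\ge0$ a.e. in $\mathbb{R}^n$. (2) There exists $1\le s<\infty$ such that $(\ast)_s$ holds. (3) For all $1\le s<\infty$, $(\ast)_s$ holds.
   Context: Cubes $Q\subset\mathbb{R}^n$ have sides parallel to the coordinate axes; $|Q|$ is Lebesgue measure; $f_Q=|Q|^{-1}\int_Q f(x)\,dx$. A weight is a nonnegative locally integrable function on $\mathbb{R}^n$, not a.e. equal to zero; $\mu(E)=\int_E\mu(x)\,dx$. $A_1$ is the Muckenhoupt class: $\mu\in A_1$ if there is a constant $C$ with $M(\mu)(x)\le C\mu(x)$ for a.e. $x$, where $M(f)(x)=\sup_{Q\ni x}\frac1{|Q|}\int_Q|f(y)|\,dy$ (supremum over all cubes containing $x$). For a cube $Q_0$ and $x\in Q_0$, $M_{Q_0}(f)(x)=\sup_{Q_0\supseteq Q\ni x}\frac1{|Q|}\int_Q|f(y)|\,dy$, the supremum being over all cubes $Q$ with $x\in Q\subseteq Q_0$. The weighted Lipschitz space $Lip_{\beta,\mu}$ is the set of $f\in L^1_{\mathrm{loc}}(\mathbb{R}^n)$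 such that $$\|f\|_{Lip_{\beta,\mu}}=\sup_Q\frac1{\mu(Q)^{1+\beta/n}}\int_Q|f(x)-f_Q|\,dx<\infty,$$ the supremum being over all cubes $Q\subset\mathbb{R}^n$. *)

(* Defs.v *)
From HB Require Import structures.
From mathcomp Require Import all_boot all_order all_algebra.
From mathcomp Require Import all_classical all_reals all_analysis.

Set Implicit Arguments.
Unset Strict Implicit.
Unset Printing Implicit Defensive.

Import Order.TTheory GRing.Theory Num.Theory.
Import numFieldNormedType.Exports.

Local Open Scope classical_set_scope.
Local Open Scope ring_scope.

(* Euclidean space of dimension n >= 1 is 'rV[R]_n.+1; the dimension written n
   in the literature is n.+1 here. *)

Section lebesgue_Rn.
Context {R : realType} {n : nat}.
Implicit Types (a b : 'rV[R]_n.+1) (A : set 'rV[R]_n.+1).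

(* The box is empty, and its volume is 0, as soon as b 0 i < a 0 i. *)
Definition box a b : set 'rV[R]_n.+1 :=
  [set x | forall i, a 0 i <= x 0 i <= b 0 i].

Definition box_volume a b : R := \prod_(i < n.+1) Num.max 0 (b 0 i - a 0 i).

Local Open Scope ereal_scope.

Definition lebesgue_outer_Rn A : \bar R :=
  ereal_inf [set \sum_(k <oo) (box_volume (c k).1 (c k).2)%:E
            | c in [set c : nat -> 'rV[R]_n.+1 * 'rV[R]_n.+1 |
                     A `<=` \bigcup_k box (c k).1 (c k).2]].

Let box_volume_ge0 a b : 0 <= (box_volume a b)%:E.
Proof. by rewrite lee_fin; apply: prodr_ge0 => i _; rewrite le_max lexx. Qed.

Lemma lebesgue_outer_Rn_ge0 A : 0 <= lebesgue_outer_Rn A.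
Proof. by apply: le_ereal_inf_tmp => _ [c _ <-]; exact: nneseries_ge0. Qed.

Lemma lebesgue_outer_Rn0 : lebesgue_outer_Rn set0 = 0.
Proof.
apply/eqP; rewrite eq_le lebesgue_outer_Rn_ge0 andbT.
apply: ereal_inf_lbound; exists (fun=> (0, 0)%R) => //=.
rewrite eseries0// => k _ _.
by rewrite /box_volume big_ord_recl !mxE subrr maxxx mul0r.
Qed.

Lemma le_lebesgue_outer_Rn :
  {homo lebesgue_outer_Rn : A B / A `<=` B >-> A <= B}.
Proof.
move=> A B AB; apply/ereal_inf_le_tmp => _ [c Bc <-].
by exists c => //; exact: subset_trans Bc.
Qed.

Lemma lebesgue_outer_Rn_sigma_subadditive :
  sigma_subadditive lebesgue_outer_Rn.
Proof.
move=> A; have [[i ioo]|] := pselect (exists i, lebesgue_outer_Rn (A i) = +oo).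
  rewrite (eseries_pinfty _ _ ioo) ?leey// => k _.
  by rewrite -ltNye (lt_le_trans _ (lebesgue_outer_Rn_ge0 _)).
rewrite -forallNE => Aoo.
suff add2e (e : {posnum R}) : lebesgue_outer_Rn (\bigcup_k A k) <=
    \sum_(i <oo) lebesgue_outer_Rn (A i) + e%:num%:E.
  by apply/lee_addgt0Pr => _/posnumP[].
rewrite (le_trans _ (epsilon_trick _ _ _))//; last first.
  by move=> k; exact: lebesgue_outer_Rn_ge0.
pose vol (p : 'rV[R]_n.+1 * 'rV[R]_n.+1) := (box_volume p.1 p.2)%:E.
have vol_ge0 p : 0 <= vol p by exact: box_volume_ge0.
pose P k (c : nat -> 'rV[R]_n.+1 * 'rV[R]_n.+1) :=
  A k `<=` \bigcup_j box (c j).1 (c j).2 /\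
  \sum_(j <oo) vol (c j) <=
    lebesgue_outer_Rn (A k) + (e%:num / (2 ^ k.+1)%:R)%:E.
have [G PG] : {G & forall k, P k (G k)}.
  apply: (@choice _ _ P) => k.
  have e0 : (0 < e%:num / (2 ^ k.+1)%:R :> R)%R by [].
  have fA : lebesgue_outer_Rn (A k) \is a fin_num.
    by rewrite ge0_fin_numE ?lebesgue_outer_Rn_ge0// ltey; apply/eqP/Aoo.
  have [_ [c Ac <-] cA] := lb_ereal_inf_adherent e0 fA.
  by exists c; split => //; exact/ltW.
have /card_esym/ppcard_eqP[f] := card_nat2.
apply: (@le_trans _ _ (\esum_(i in setT) (vol \o uncurry G) i)).
  apply: ereal_inf_lbound; exists (uncurry G \o f) => [t [i _ Ait]|].
    have [j _ Gt] := (PG i).1 _ Ait.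
    by exists (f^-1%FUN (i, j)) => //=; rewrite invK ?inE.
  rewrite (_ : (fun N => _) = fun N => \sum_(0 <= k < N) (vol \o uncurry G) (f k))//.
  rewrite -(esum_pred_image (vol \o uncurry G) _ xpredT) ?[fun=> _]set_true//.
    by rewrite image_eq.
  by move=> k _; exact: vol_ge0.
rewrite (_ : esum _ _ = \sum_(i <oo) \sum_(j <oo) vol (G i j)).
  by apply: lee_nneseries => [i _ _|i _];
    [exact: nneseries_ge0|exact: (PG i).2].
pose J : nat -> set (nat * nat) := fun i => [set (i, j) | j in setT].
rewrite (_ : setT = \bigcup_k J k); last first.
  by rewrite predeqE => -[a b]; split => // _; exists a => //; exists b.
rewrite esum_bigcupT /=; last 2 first.
- apply/trivIsetP => i j _ _ ij.
  rewrite predeqE => -[k m] /=; split => //= -[] [_] _ [<-{k} _].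
  by move=> [m' _] [] /esym/eqP; rewrite (negbTE ij).
- by move=> *; exact: vol_ge0.
rewrite -(image_id [set: nat]) -fun_true esum_pred_image//; last first.
  by move=> k _; apply: esum_ge0 => *; exact: vol_ge0.
apply: eq_eseriesr => /= j _.
rewrite -(esum_pred_image (vol \o uncurry G) (pair j) predT)//=; last first.
  by move=> ? ? _ _; exact: (@can_inj _ _ _ snd).
by congr esum; rewrite predeqE => -[a b]; split; move=> [i _ <-]; exists i.
Qed.

HB.instance Definition _ := isOuterMeasure.Build R 'rV[R]_n.+1
  lebesgue_outer_Rn lebesgue_outer_Rn0 lebesgue_outer_Rn_ge0
  le_lebesgue_outer_Rn lebesgue_outer_Rn_sigma_subadditive.

(* The measurable sets of 'rV[R]_n.+1 are the Lebesgue measurable ones, in the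
   sense of Caratheodory; in particular the measure is complete. *)
HB.instance Definition _ :=
  Measurable.copy 'rV[R]_n.+1 (caratheodory_type lebesgue_outer_Rn).

Definition lebesgue_measure_Rn : set 'rV[R]_n.+1 -> \bar R := lebesgue_outer_Rn.

HB.instance Definition _ := isMeasure.Build _ 'rV[R]_n.+1 R lebesgue_measure_Rn
  (@caratheodory_measure0 _ _ lebesgue_outer_Rn)
  (@caratheodory_measure_ge0 _ _ lebesgue_outer_Rn)
  (@caratheodory_measure_sigma_additive _ _ lebesgue_outer_Rn).

End lebesgue_Rn.

Section cubes_and_maximal_functions.
Context {R : realType} {n : nat}.
Implicit Types (f w : 'rV[R]_n.+1 -> R) (Q E : set 'rV[R]_n.+1) (s beta : R).

Local Notation leb := (@lebesgue_measure_Rn R n).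

(* Closed cubes of positive side length; the faces are Lebesgue negligible, so
   open cubes would give the same theory. *)
Definition cubes : set (set 'rV[R]_n.+1) :=
  [set Q | exists a : 'rV[R]_n.+1, exists2 l : R,
    0 < l & Q = box a (a + const_mx l)].

Local Open Scope ereal_scope.

Definition locally_integrable_Rn f : Prop :=
  measurable_fun [set: 'rV[R]_n.+1] f /\
  forall K : set 'rV[R]_n.+1, compact K ->
    \int[leb]_(x in K) `|f x|%:E < +oo.

Definition cube_mean f Q : R :=
  ((fine (leb Q))^-1 * \int[leb]_(x in Q) f x)%R.

Definition maximal f (x : 'rV[R]_n.+1) : \bar R :=
  ereal_sup [set (leb Q)^-1 * \int[leb]_(y in Q) `|f y|%:E
            | Q in [set Q | cubes Q /\ Q x]].

Definition local_maximal (Q0 : set 'rV[R]_n.+1) f (x : 'rV[R]_n.+1) : \bar R :=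
  ereal_sup [set (leb Q)^-1 * \int[leb]_(y in Q) `|f y|%:E
            | Q in [set Q | [/\ cubes Q, Q x & Q `<=` Q0]]].

Definition weight w : Prop :=
  [/\ forall x, (0 <= w x)%R, locally_integrable_Rn w &
      ~ {ae leb, forall x, w x = 0%R}].

Definition wmeasure w E : \bar R := \int[leb]_(x in E) (w x)%:E.

Definition A1 w : Prop :=
  weight w /\
  exists C : R, {ae leb, forall x, maximal w x <= (C * w x)%:E}.

Definition Lip_norm beta w f : \bar R :=
  ereal_sup [set (wmeasure w Q `^ (1 + beta / n.+1%:R))^-1 *
                 \int[leb]_(x in Q) `|f x - cube_mean f Q|%:E
            | Q in cubes].

Definition Lip beta w f : Prop :=
  locally_integrable_Rn f /\ Lip_norm beta w f < +oo.

(* For 1 < s the factor w x `^ (1 - s) is 0, by convention, at the zeros of w;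
   an A_1 weight is a.e. positive, so these do not contribute. *)
Definition maximal_oscillation_bounded beta w f s : Prop :=
  exists C : R,
    ereal_sup [set (wmeasure w Q `^ (beta / n.+1%:R))^-1 *
                   ((wmeasure w Q)^-1 *
                    \int[leb]_(x in Q)
                      (`|(f x)%:E - local_maximal Q f x| `^ s *
                       (w x `^ (1 - s))%:E)) `^ s^-1
              | Q in cubes] <= C%:E.

End cubes_and_maximal_functions.

(* Main.v *)
(* (1) => (3). The A_1 condition says that mu(Q) / |Q| <= C mu(x) for every cube
   Q and almost every x in Q, hence also that halving the side of a cube
   multiplies its mu-measure by at most some g < 1. For cubes Q' inside Q and
   x in Q', telescoping |b_Q' - b_Q| along a chain of cubes with sides halved at
   each step therefore gives a geometric series, bounded by
   D mu(x) mu(Q)^(beta/n). The same bound holds for |b(x) - b_Q|: its excess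
   f >= 0 over the bound satisfies int_P f <= int_P |b - b_P|
   <= L mu(P)^(1 + beta/n) for all cubes P inside Q, and splitting P into its
   2^n halves improves the constant by the factor g^(beta/n), so f = 0 a.e. No
   differentiation theorem is needed. As b >= 0, M_Q(b)(x) is a supremum of
   means b_Q', so |b - M_Q(b)| <= D mu(x) mu(Q)^(beta/n) a.e. on Q.

   (2) => (1). As M_Q(b) >= |b|_Q on Q, the function (|b|_Q - b)^+ is at most
   |b - M_Q(b)|, so its integral is O(mu(Q)^(1 + beta/n)) by a crude form of
   Hoelder's inequality. It controls the oscillation of b, and also
   2 int_Q b^- = int_Q (|b|_Q - b), so that b^- = 0 a.e. by the same
   splitting. *)

Require Import Defs.
From mathcomp Require Import all_boot all_order all_algebra.
From mathcomp Require Import all_classical all_reals all_analysis.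
From mathcomp Require Import measurable_realfun.
From mathcomp Require Import ring lra.

Set Implicit Arguments.
Unset Strict Implicit.
Unset Printing Implicit Defensive.

Import Order.TTheory GRing.Theory Num.Theory.
Import numFieldNormedType.Exports.

Local Open Scope classical_set_scope.
Local Open Scope ring_scope.

(** * Scaling of the outer measure, and measurability of boxes *)

Section lebesgue_measure_of_boxes.
Context {R : realType} {n : nat}.
Implicit Types (a b c x : 'rV[R]_n.+1) (A B X : set 'rV[R]_n.+1) (t l : R).

Local Notation leb := (@lebesgue_measure_Rn R n).

Lemma box_volume_ge0 a b : 0 <= box_volume a b.
Proof. by apply: prodr_ge0 => i _; rewrite le_max lexx. Qed.

(** Pulling a cover of [B] by boxes back along the map $x \mapsto tx + c$ covers [A] by boxes whose
    volumes are divided by $t^{n+1}$. *)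
Lemma lebesgue_outer_Rn_affine t c A B : 0 < t ->
  (forall x, A x -> B (t *: x + c)) ->
  ((t ^+ n.+1)%:E * lebesgue_outer_Rn A <= lebesgue_outer_Rn B)%E.
Proof.
move=> t0 AB; apply: le_ereal_inf_tmp => _ [e Be <-].
pose e' k := (t^-1 *: ((e k).1 - c), t^-1 *: ((e k).2 - c)).
have vol k : box_volume (e k).1 (e k).2
    = t ^+ n.+1 * box_volume (e' k).1 (e' k).2.
  rewrite /box_volume -[in t ^+ _](card_ord n.+1) -prodr_const -big_split /=.
  apply: eq_bigr => i _; rewrite !mxE maxr_pMr ?(ltW t0)// mulr0; congr Num.max.
  by field; rewrite gt_eqF.
rewrite (eq_eseriesr (fun k _ => congr1 EFin (vol k))).
under eq_eseriesr do rewrite EFinM.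
rewrite nneseriesZl; last by move=> k _; rewrite lee_fin box_volume_ge0.
apply: lee_wpmul2l; first by rewrite lee_fin exprn_ge0// ltW.
apply: ereal_inf_lbound; exists e' => //= x /AB/Be[k _ ek].
exists k => // i; move: (ek i); rewrite !mxE => /andP[h1 h2].
by rewrite ler_pdivrMl// ler_pdivlMl// lerBlDr lerBrDr h1 h2.
Qed.

(** The hyperplane $x_i = t$ cuts every box of a cover into two boxes whose volumes add up to that
    of the original one, which is Caratheodory's criterion. The boxes [e1 k] and [e2 k] are these
    two pieces. *)
Lemma measurable_halfspace (i : 'I_n.+1) t :
  measurable [set x : 'rV[R]_n.+1 | x 0 i <= t].
Proof.
apply: le_caratheodory_measurable => X; apply: le_ereal_inf_tmp => _ [e Xe <-].
pose e1 k := ((e k).1,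
  \row_j if j == i then Num.min t ((e k).2 0 j) else (e k).2 0 j).
pose e2 k := (\row_j (if j == i then Num.max t ((e k).1 0 j) else (e k).1 0 j),
  (e k).2).
have vol k : box_volume (e k).1 (e k).2 = box_volume (e1 k).1 (e1 k).2 +
    box_volume (e2 k).1 (e2 k).2.
  rewrite /box_volume (bigD1 i)//= [in X in _ = X + _](bigD1 i)//=.
  rewrite [in X in _ = _ + X](bigD1 i)//= !mxE eqxx.
  rewrite [X in _ = _ * X + _](eq_bigr
    (fun j => Num.max 0 ((e k).2 0 j - (e k).1 0 j))); last first.
    by move=> j ji; rewrite mxE (negbTE ji).
  rewrite [X in _ = _ + _ * X](eq_bigr
    (fun j => Num.max 0 ((e k).2 0 j - (e k).1 0 j))); last first.
    by move=> j ji; rewrite mxE (negbTE ji).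
  rewrite -mulrDl; congr (_ * _).
  move: ((e k).2 0 i) ((e k).1 0 i) => v u.
  rewrite /Num.max /Num.min; repeat case: ifPn; rewrite -?leNgt; lra.
rewrite (eq_eseriesr (fun k _ => congr1 EFin (vol k))).
under eq_eseriesr do rewrite EFinD.
rewrite nneseriesD; try by move=> k _ _; rewrite lee_fin box_volume_ge0.
apply: leeD; apply: ereal_inf_lbound.
- exists e1 => //= x [/Xe[k _ ek] xt]; exists k => // j; rewrite mxE.
  case: ifPn => [/eqP ->|_]; last exact: ek.
  by case/andP: (ek i) => -> h; rewrite le_min xt h.
- exists e2 => //= x [/Xe[k _ ek] /negP]; rewrite -ltNge => /ltW xt.
  exists k => // j; rewrite mxE.
  case: ifPn => [/eqP ->|_]; last exact: ek.
  by case/andP: (ek i) => h ->; rewrite ge_max xt h.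
Qed.

Lemma measurable_lt_halfspace (i : 'I_n.+1) t :
  measurable [set x : 'rV[R]_n.+1 | x 0 i < t].
Proof.
have -> : [set x : 'rV[R]_n.+1 | x 0 i < t] =
    \bigcup_(k : nat) [set x | x 0 i <= t - k.+1%:R^-1].
  apply/seteqP; split => [x /= xt|x [k _ /=] h]; last first.
    by apply: le_lt_trans h _; rewrite ltrBlDr ltrDl.
  have [k kt] := ltr_add_invr xt.
  by exists k => //=; rewrite lerBrDr ltW.
by apply: bigcupT_measurable => k; exact: measurable_halfspace.
Qed.

Lemma measurable_hyperplane (i : 'I_n.+1) t :
  measurable [set x : 'rV[R]_n.+1 | x 0 i = t].
Proof.
have -> : [set x : 'rV[R]_n.+1 | x 0 i = t] =
    [set x | x 0 i <= t] `&` ~` [set x | x 0 i < t].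
  apply/seteqP; split => [x xt|x [/= h /negP]].
    by rewrite /setI/= (xt : x 0 i = t) lexx ltxx.
  by rewrite -leNgt => h'; apply/eqP; rewrite eq_le h h'.
apply: measurableI; first exact: measurable_halfspace.
by apply: measurableC; exact: measurable_lt_halfspace.
Qed.

Lemma measurable_box a b : measurable (box a b).
Proof.
have -> : box a b = \bigcap_(i in [set: 'I_n.+1])
    (~` [set x : 'rV[R]_n.+1 | x 0 i < a 0 i] `&` [set x | x 0 i <= b 0 i]).
  apply/seteqP; split => [x xab i _|x xab i] /=.
    by have /andP[h1 h2] := xab i; split=> //=; apply/negP; rewrite -leNgt.
  by have [/negP h1 h2] := xab i I; rewrite leNgt h1 h2.
apply: fin_bigcap_measurable => // i _; apply: measurableI.
  by apply: measurableC; exact: measurable_lt_halfspace.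
exact: measurable_halfspace.
Qed.

Lemma lebesgue_box_le a b : (leb (box a b) <= (box_volume a b)%:E)%E.
Proof.
pose e k := if k is 0%N then (a, b) else (0, 0) : 'rV[R]_n.+1 * 'rV[R]_n.+1.
have -> : (box_volume a b)%:E =
    (\sum_(k <oo) (box_volume (e k).1 (e k).2)%:E)%E.
  rewrite (@nneseries_split _ _ 0 1); last first.
    by move=> k _; rewrite lee_fin box_volume_ge0.
  rewrite add0n big_nat1 eseries0 ?adde0// => -[//|k] _ _ /=.
  by rewrite /box_volume big_ord_recl !mxE subrr maxxx mul0r.
by apply: ereal_inf_lbound; exists e => //= x xab; exists 0%N.
Qed.

Lemma lebesgue_box_hyperplane (i : 'I_n.+1) a b t :
  leb (box a b `&` [set x | x 0 i = t]) = 0%E.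
Proof.
apply/eqP; rewrite eq_le measure_ge0 andbT.
(* The slice lies in a box of zero width in direction [i]. *)
pose a' := \row_j if j == i then t else a 0 j.
pose b' := \row_j if j == i then t else b 0 j.
have -> : (0 = (box_volume a' b')%:E)%E.
  by rewrite /box_volume (bigD1 i)//= !mxE eqxx subrr maxxx mul0r.
apply: le_trans (lebesgue_box_le _ _); apply: le_outer_measure => x [xab xt] j.
by rewrite !mxE; case: ifPn => [/eqP ->|_]; [rewrite xt lexx|exact: xab].
Qed.

End lebesgue_measure_of_boxes.

(** * Inclusions between cubes, their volume, and their division into halves *)

Section cube_geometry.
Context {R : realType} {n : nat}.
Implicit Types (a c x : 'rV[R]_n.+1) (Q P : set 'rV[R]_n.+1) (l : R).

Local Notation leb := (@lebesgue_measure_Rn R n).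

Definition cube a l : set 'rV[R]_n.+1 := box a (a + const_mx l).

Lemma cubeP a l x :
  cube a l x <-> forall i, a 0 i <= x 0 i <= a 0 i + l.
Proof.
by split=> h i; move: (h i); rewrite !mxE.
Qed.

Lemma cube_in_cubes a l : 0 < l -> cubes (cube a l).
Proof. by move=> l0; exists a, l. Qed.

Lemma corner_cube a l : 0 <= l -> cube a l a.
Proof. by move=> l0; apply/cubeP => i; rewrite lexx lerDl. Qed.

Lemma subset_cube_corner a l a' l' : 0 <= l -> 0 <= l' ->
  cube a' l' `<=` cube a l ->
  forall i, a 0 i <= a' 0 i /\ a' 0 i + l' <= a 0 i + l.
Proof.
move=> l0 l'0 sub i.
have /cubeP/(_ i)/andP[-> _] := sub _ (corner_cube a' l'0); split => //.
have /sub/cubeP/(_ i) : cube a' l' (a' + const_mx l').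
  by apply/cubeP => j; rewrite !mxE lerDl l'0 lexx.
by rewrite !mxE => /andP[].
Qed.

Lemma subset_cube a l a' l' :
  (forall i, a 0 i <= a' 0 i /\ a' 0 i + l' <= a 0 i + l) ->
  cube a' l' `<=` cube a l.
Proof.
move=> h x /cubeP xQ; apply/cubeP => i; have [h1 h2] := h i.
have /andP[h3 h4] := xQ i.
by rewrite (le_trans h1 h3) (le_trans h4 h2).
Qed.

Lemma subset_cube_side a l a' l' : 0 <= l -> 0 <= l' ->
  cube a' l' `<=` cube a l -> l' <= l.
Proof. by move=> l0 l'0 /subset_cube_corner-/(_ l0 l'0 0)[]; lra. Qed.

Lemma cube_between a l a' l' : 0 < l' -> 2 * l' <= l ->
  cube a' l' `<=` cube a l ->
  exists c, cube a' l' `<=` cube c (l / 2) /\ cube c (l / 2) `<=` cube a l.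
Proof.
move=> l'0 l'l sub; have l0 : 0 <= l by lra.
have h := subset_cube_corner l0 (ltW l'0) sub.
(* The corner of the small cube, lowered in each coordinate just enough for a cube of side [l / 2]
   to stay inside the large one. *)
exists (\row_i Num.min (a' 0 i) (a 0 i + l / 2)).
split; apply: subset_cube => i; have [h1 h2] := h i;
  rewrite mxE /Num.min; case: ifPn; rewrite -?leNgt; lra.
Qed.

Lemma measurable_cube a l : measurable (cube a l).
Proof. exact: measurable_box. Qed.

Lemma compact_cube a l : compact (cube a l).
Proof.
rewrite (_ : cube a l = [set x : 'rV[R]_n.+1 |
    forall i, `[a 0 i, a 0 i + l]%classic (x ord0 i)]).
  apply: (@rV_compact R n.+1 (fun i => `[a 0 i, a 0 i + l]%classic)) => i.
  exact: segment_compact.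
apply/seteqP; split => x.
  by move/cubeP => xQ i; rewrite /= in_itv/=.
by move=> xQ; apply/cubeP => i; have := xQ i; rewrite /= in_itv/=.
Qed.

Definition unit_volume : R := fine (leb (cube 0 1)).

Lemma unit_volumeE : leb (cube 0 1) = unit_volume%:E.
Proof.
rewrite fineK// ge0_fin_numE//.
by apply: le_lt_trans (lebesgue_box_le _ _) _; rewrite ltry.
Qed.

(* [unit_volume] is 1, but the scaling law and positivity, deduced from [leb] not
   being the zero measure, are all that is needed. *)
Definition volume l : R := l ^+ n.+1 * unit_volume.

(** Both inequalities are instances of the scaling inequality: one for the affine map of the cube
    onto the unit cube, one for its inverse. *)
Lemma lebesgue_cube a l : 0 < l -> leb (cube a l) = (volume l)%:E.
Proof.
move=> l0; rewrite /volume EFinM -unit_volumeE; apply/eqP; rewrite eq_le.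
apply/andP; split.
  have : ((l^-1 ^+ n.+1)%:E * lebesgue_outer_Rn (cube a l) <=
          lebesgue_outer_Rn (cube 0 1))%E.
    apply: (@lebesgue_outer_Rn_affine _ _ _ (- (l^-1 *: a))).
      by rewrite invr_gt0.
    move=> x /cubeP xQ; apply/cubeP => i; have /andP[h1 h2] := xQ i.
    rewrite !mxE -mulrBr mulr_ge0 ?invr_ge0 ?(ltW l0) ?subr_ge0//=.
    by rewrite ler_pdivrMl// add0r mulr1 lerBlDl.
  by rewrite exprVn lee_pdivrMl ?exprn_gt0.
apply: (@lebesgue_outer_Rn_affine _ _ _ a) => //.
move=> x /cubeP xQ; apply/cubeP => i; have := xQ i.
rewrite !mxE add0r => /andP[h1 h2].
by rewrite lerDr mulr_ge0 ?(ltW l0)//= addrC lerD2l -[leRHS]mulr1 ler_pM2l.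
Qed.

Definition centered_cube (k : nat) : set 'rV[R]_n.+1 :=
  cube (const_mx (- k.+1%:R)) (2 * k.+1%:R).

Lemma subset_centered_cube a l : exists k, cube a l `<=` centered_cube k.
Proof.
pose M := \sum_i `|a 0 i| + `|l|.
have aM i : `|a 0 i| + `|l| <= M.
  by rewrite lerD2r (bigD1 i)//= lerDl sumr_ge0.
exists (Num.truncn M); set k := (Num.truncn M).+1.
have Mk : M < k%:R by exact: truncnS_gt.
apply: subset_cube => i; rewrite mxE -/k.
have := aM i; have := ler_norm l; have := ler_norm (a 0 i).
have := ler_norm (- a 0 i); rewrite normrN; have := normr_ge0 l; lra.
Qed.

Lemma bigcup_centered_cube : \bigcup_k centered_cube k = setT.
Proof.
apply/seteqP; split => // x _.
have [k xk] := subset_centered_cube x 0.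
by exists k => //; exact/xk/corner_cube.
Qed.

(** If the unit cube were null, then by scaling so would be all cubes, hence the whole space, a
    countable union of cubes. *)
Lemma unit_volume_gt0 : leb setT != 0%E -> 0 < unit_volume.
Proof.
apply: contraR; rewrite -leNgt => u0.
have {}u0 : unit_volume = 0.
  by apply/eqP; rewrite eq_le u0 fine_ge0.
apply/eqP; apply/negligibleP => //; rewrite -bigcup_centered_cube.
apply: negligible_bigcup => k; apply/negligibleP; first exact: measurable_cube.
by rewrite [LHS]lebesgue_cube ?mulr_gt0// /volume u0 mulr0.
Qed.

Lemma locally_integrable_cube f a l :
  locally_integrable_Rn f -> leb.-integrable (cube a l) (EFin \o f).
Proof.
move=> [mf fK]; apply/integrableP; split.
  by apply/measurable_EFinP; exact: measurable_funS mf.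
exact/fK/compact_cube.
Qed.

(** In each coordinate [s] selects the upper or the lower half. The pieces are closed and share
    faces. *)
Definition subcube a l (s : {ffun 'I_n.+1 -> bool}) : set 'rV[R]_n.+1 :=
  cube (a + \row_i (if s i then l / 2 else 0)) (l / 2).

Lemma subcubeP a l s x : subcube a l s x <-> forall i,
  if s i then a 0 i + l / 2 <= x 0 i <= a 0 i + l
  else a 0 i <= x 0 i <= a 0 i + l / 2.
Proof.
split => [/cubeP h i|h]; last apply/cubeP => i;
  move: (h i); rewrite !mxE; case: (s i);
  move/andP=> [h1 h2]; apply/andP; split; lra.
Qed.

Lemma subcube_sub a l s : 0 <= l -> subcube a l s `<=` cube a l.
Proof.
by move=> l0; apply: subset_cube => i; rewrite !mxE; case: (s i); lra.
Qed.

(** The pieces overlap only on the middle hyperplanes. Off this null set [N] they partition the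
    cube. *)
Lemma ge0_integral_subcubes (f : 'rV[R]_n.+1 -> \bar R) a l : 0 <= l ->
  measurable_fun (cube a l) f -> (forall x, 0 <= f x)%E ->
  (\int[leb]_(x in cube a l) f x =
   \sum_(s : {ffun 'I_n.+1 -> bool}) \int[leb]_(x in subcube a l s) f x)%E.
Proof.
move=> l0 mf f0.
(* Indexing by [nat] through [inord] allows countable unions; the indices above [n] merely repeat
   coordinate 0. *)
pose F (k : nat) := cube a l `&`
  [set x | x 0 (inord k : 'I_n.+1) = a 0 (inord k) + l / 2].
have mF k : measurable (F k).
  apply: measurableI; first exact: measurable_cube.
  exact: measurable_hyperplane.
pose N := \bigcup_k F k.
have mN : measurable N by exact: bigcupT_measurable.
have N0 : leb N = 0%E.
  apply/negligibleP => //; apply: negligible_bigcup => k.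
  by apply/negligibleP => //; exact: lebesgue_box_hyperplane.
have mS s : measurable (subcube a l s) by exact: measurable_cube.
rewrite (ge0_negligible_integral mN)//; last exact: measurable_cube.
under [RHS]eq_bigr => s _.
  rewrite (ge0_negligible_integral mN)//; last first.
    apply: measurable_funS mf => //; first exact: measurable_cube.
    exact: subcube_sub.
  over.
have NP x : cube a l x -> ~ N x -> forall i, x 0 i != a 0 i + l / 2.
  move=> xQ xN i; apply/eqP => xi; apply: xN.
  by exists (i : nat) => //; split => //=; rewrite inord_val.
have cover : cube a l `\` N = \big[setU/set0]_(s : {ffun 'I_n.+1 -> bool})
    (subcube a l s `\` N).
  rewrite -bigcup_seq.
  apply/seteqP; split => [x [xQ xN]|x [s _ [xs xN]]]; last first.
    by split => //; apply: subcube_sub xs.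
  exists [ffun i => a 0 i + l / 2 < x 0 i]; first by rewrite /= mem_index_enum.
  split => //; apply/subcubeP => i; rewrite ffunE.
  move/cubeP/(_ i) : xQ => /andP[-> ->]; rewrite andbT/=.
  by case: ltP => // /ltW.
rewrite cover ge0_integral_bigsetU//.
- by move=> s; exact: measurableD.
- exact: index_enum_uniq.
- apply/trivIsetP => s s' _ _ /negP ss'; rewrite -subset0.
  move=> x [[xs xN] [xs' _]]; apply: ss'; apply/eqP/ffunP => i.
  have := NP x (subcube_sub l0 xs) xN i.
  move/subcubeP/(_ i) : xs; move/subcubeP/(_ i) : xs'.
  case: (s i) (s' i) => -[]// /andP[h1 h2] /andP[h3 h4] /eqP h;
  exfalso; apply: h.
    by apply/eqP; rewrite eq_le h2 h3.
  by apply/eqP; rewrite eq_le h4 h1.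
- rewrite -cover; apply: measurable_funS mf; first exact: measurable_cube.
  by move=> x [].
Qed.

End cube_geometry.

(** * Comparison of integrals, including those of functions not known to be measurable *)

Section integral_comparison.
Context d (T : measurableType d) (R : realType).
Variable mu : {measure set T -> \bar R}.
Implicit Types (D : set T).

Import HBNNSimple.

(* The integral of a nonnegative function, measurable or not, is a supremum of
   integrals of simple functions, so that only the upper bound has to be
   measurable. *)
Lemma ae_ge0_le_lower_integral D (f g : T -> \bar R) :
  measurable D -> measurable_fun D g ->
  (forall x, D x -> 0 <= f x)%E -> (forall x, D x -> 0 <= g x)%E ->
  {ae mu, forall x, D x -> (f x <= g x)%E} ->
  (\int[mu]_(x in D) f x <= \int[mu]_(x in D) g x)%E.
Proof.
move=> mD mg f0 g0 fg; rewrite (integral_mkcond _ f) (integral_mkcond _ g).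
rewrite ge0_integralTE; last first.
  by move=> x; rewrite patchE; case: ifPn => // /set_mem; exact: f0.
apply: ge_ereal_sup => _ [h /= hf <-]; rewrite -integralT_nnsfun.
apply: ae_ge0_le_integral => //.
- by move=> x _; rewrite lee_fin; exact: fun_ge0.
- exact/measurable_EFinP/measurable_funP.
- by move=> x _; rewrite patchE; case: ifPn => // /set_mem; exact: g0.
- exact/(measurable_restrictT _ _).1.
- apply: filterS fg => x fgx _; apply: le_trans (hf x) _.
  by rewrite !patchE; case: ifPn => // /set_mem; exact: fgx.
Qed.

(** Every simple function below [f] is below [g]. This serves when the upper bound [g] involves a
    local maximal function. *)
Lemma ge0_le_lower_integral D (f g : T -> \bar R) :
  (forall x, D x -> 0 <= f x)%E -> (forall x, D x -> f x <= g x)%E ->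
  (\int[mu]_(x in D) f x <= \int[mu]_(x in D) g x)%E.
Proof.
move=> f0 fg; rewrite (integral_mkcond _ f) (integral_mkcond _ g).
have g0 x : D x -> (0 <= g x)%E.
  by move=> Dx; exact: le_trans (f0 _ Dx) (fg _ Dx).
rewrite !ge0_integralTE; last first.
- by move=> x; rewrite patchE; case: ifPn => // /set_mem; exact: f0.
- by move=> x; rewrite patchE; case: ifPn => // /set_mem; exact: g0.
apply: ereal_sup_le => _ [h /= hf <-]; exists h => //.
move=> x; apply: le_trans (hf x) _.
by rewrite !patchE; case: ifPn => // /set_mem; exact: fg.
Qed.

Lemma EFin_Rintegral D (f : T -> R) : measurable D ->
  mu.-integrable D (EFin \o f) ->
  (\int[mu]_(x in D) (f x)%:E)%E = (\int[mu]_(x in D) f x)%:E.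
Proof.
by move=> mD fi; rewrite /Rintegral fineK//; exact: integrable_fin_num.
Qed.

Lemma ae_ge0_le_Rintegral D (f g : T -> R) : measurable D ->
  mu.-integrable D (EFin \o f) -> mu.-integrable D (EFin \o g) ->
  (forall x, D x -> 0 <= f x) -> (forall x, D x -> 0 <= g x) ->
  {ae mu, forall x, D x -> f x <= g x} ->
  \int[mu]_(x in D) f x <= \int[mu]_(x in D) g x.
Proof.
move=> mD fi gi f0 g0 fg; rewrite -lee_fin -!EFin_Rintegral//.
apply: ae_ge0_le_integral => //.
- exact: measurable_int fi.
- exact: measurable_int gi.
Qed.

Lemma Rintegral_setD A B (f : T -> R) : measurable A -> measurable B ->
  B `<=` A -> mu.-integrable A (EFin \o f) ->
  \int[mu]_(x in A `\` B) f x = \int[mu]_(x in A) f x - \int[mu]_(x in B) f x.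
Proof.
move=> mA mB BA fi; apply/eqP; rewrite eq_sym subr_eq addrC; apply/eqP.
rewrite -[in LHS](setDUK BA) Rintegral_setU//.
- exact: measurableD.
- by rewrite setDUK.
- by rewrite disj_set2E setDIK.
Qed.

Lemma ge0_subset_Rintegral A B (f : T -> R) : measurable A -> measurable B ->
  B `<=` A -> mu.-integrable A (EFin \o f) -> (forall x, 0 <= f x) ->
  \int[mu]_(x in B) f x <= \int[mu]_(x in A) f x.
Proof.
move=> mA mB BA fi f0; rewrite -subr_ge0 -Rintegral_setD//.
by apply: Rintegral_ge0 => x _.
Qed.

Lemma Rintegral_eq0_ae D (f : T -> R) : measurable D ->
  mu.-integrable D (EFin \o f) -> (forall x, 0 <= f x) ->
  \int[mu]_(x in D) f x = 0 -> {ae mu, forall x, D x -> f x = 0}.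
Proof.
move=> mD fi f0 f_eq0.
have : ae_eq mu D (EFin \o f) (cst 0%E).
  apply/ae_eq_integral_abs => //; first exact: measurable_int fi.
  rewrite -[RHS]/(0%:E) -f_eq0 -EFin_Rintegral//.
  by apply: eq_integral => x _ /=; rewrite ger0_norm.
by apply: filterS => x h Dx; have [] := h Dx.
Qed.

End integral_comparison.

(** * Means and integrals over cubes *)

Section integrals_over_cubes.
Context {R : realType} {n : nat}.
Implicit Types (a c x : 'rV[R]_n.+1) (l : R).

Local Notation leb := (@lebesgue_measure_Rn R n).
Local Notation u := (@unit_volume R n).
Local Notation vol := (@volume R n).

Lemma integrable_cst_cube a l k : 0 < l ->
  leb.-integrable (cube a l) (EFin \o cst k).
Proof.
move=> l0; apply: measurable_bounded_integrable => //.
- exact: measurable_cube.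
- by rewrite [X in (X < _)%E]lebesgue_cube// ltry.
- exact: bounded_cst.
Qed.

Lemma Rintegral_cst_cube a l k : 0 < l ->
  \int[leb]_(x in cube a l) k = k * vol l.
Proof.
move=> l0; rewrite Rintegral_cst; last exact: measurable_cube.
by rewrite [X in fine X]lebesgue_cube.
Qed.

Lemma cube_meanE (f : 'rV[R]_n.+1 -> R) a l : 0 < l -> 0 < u ->
  \int[leb]_(x in cube a l) f x = vol l * cube_mean f (cube a l).
Proof.
move=> l0 u0; rewrite /cube_mean lebesgue_cube//= mulVKf// mulf_neq0 ?gt_eqF//.
by rewrite exprn_gt0.
Qed.

Lemma Rintegral_subcubes (f : 'rV[R]_n.+1 -> R) a l : 0 < l ->
  (forall c r, 0 < r -> leb.-integrable (cube c r) (EFin \o f)) ->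
  (forall x, 0 <= f x) ->
  \int[leb]_(x in cube a l) f x =
  \sum_(s : {ffun 'I_n.+1 -> bool}) \int[leb]_(x in subcube a l s) f x.
Proof.
move=> l0 fi f0; have l20 : 0 < l / 2 by rewrite divr_gt0.
apply: EFin_inj.
rewrite -EFin_Rintegral; [|exact: measurable_cube|exact: fi].
rewrite (ge0_integral_subcubes (ltW l0)) => [|| x]; last 2 first.
- exact: (measurable_int leb (fi a l l0)).
- by rewrite lee_fin.
rewrite -sumEFin; apply: eq_bigr => s _.
by rewrite EFin_Rintegral//; [exact: measurable_cube|exact: fi].
Qed.

Lemma ae_eq0_of_Rintegral_cube (f : 'rV[R]_n.+1 -> R) :
  (forall c r, 0 < r -> leb.-integrable (cube c r) (EFin \o f)) ->
  (forall x, 0 <= f x) ->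
  (forall k, \int[leb]_(x in centered_cube k) f x = 0) ->
  {ae leb, forall x, f x = 0}.
Proof.
move=> fi f0 fk.
have : forall k, {ae leb, forall x, centered_cube k x -> f x = 0}.
  move=> k; apply: Rintegral_eq0_ae => //; first exact: measurable_cube.
  by apply: fi; rewrite mulr_gt0.
move/ae_foralln; apply: filterS => x h.
have [k _ kx] : (\bigcup_k centered_cube k) x by rewrite bigcup_centered_cube.
exact: h kx.
Qed.

End integrals_over_cubes.

(** * Consequences of the A_1 condition: positivity, reverse doubling, and the splitting argument *)

Section A1_weights.
Context {R : realType} {n : nat}.
Implicit Types (a c x : 'rV[R]_n.+1) (l : R).
Variable mu : 'rV[R]_n.+1 -> R.
Hypothesis muA1 : A1 mu.

Local Notation leb := (@lebesgue_measure_Rn R n).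
Local Notation u := (@unit_volume R n).
Local Notation vol := (@volume R n).
Local Notation m Q := (\int[leb]_(x in Q) mu x).

Let mu_ge0 x : 0 <= mu x. Proof. by have [[]] := muA1. Qed.

Let mu_loc : locally_integrable_Rn mu. Proof. by have [[]] := muA1. Qed.

Let mu_int a l : leb.-integrable (cube a l) (EFin \o mu).
Proof. exact: locally_integrable_cube. Qed.

(** A weight is not a.e. zero, so Lebesgue measure is not the zero measure. *)
Lemma A1_unit_volume_gt0 : 0 < u.
Proof.
apply: unit_volume_gt0; have [[_ _ mu0] _] := muA1.
apply: contra_notN mu0 => /eqP T0.
by exists setT; split => // x _.
Qed.

Let u_gt0 := A1_unit_volume_gt0.

Lemma volume_gt0 l : 0 < l -> 0 < vol l.
Proof. by move=> l0; rewrite mulr_gt0// exprn_gt0. Qed.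

Lemma wmeasure_cubeE a l : wmeasure mu (cube a l) = (m (cube a l))%:E.
Proof. by apply: EFin_Rintegral => //; exact: measurable_cube. Qed.

(** The value of the maximal function at [x] bounds the means over all cubes through [x] at once, so
    a single null set serves for every cube. Taking [C] at least 1 makes division by it harmless
    later. *)
Lemma A1_ge_mean : exists2 C : R, 1 <= C & {ae leb, forall x, forall a l,
  0 < l -> cube a l x -> m (cube a l) <= C * vol l * mu x}.
Proof.
have [_ [C hC]] := muA1; exists (Num.max 1 C); first by rewrite le_max lexx.
apply: filterS hC => x hx a l l0 xQ.
have v0 := volume_gt0 l0.
have : ((m (cube a l) / vol l)%:E <= (C * mu x)%:E)%E.
  apply: le_trans hx; apply: ereal_sup_ubound; exists (cube a l).
    by split => //; exact: cube_in_cubes.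
  rewrite lebesgue_cube// inver gt_eqF// mulrC EFinM -wmeasure_cubeE.
  congr (_ * _)%E; apply: eq_integral => y _.
  by rewrite ger0_norm.
rewrite lee_fin ler_pdivrMr// => /le_trans; apply.
rewrite [leRHS]mulrAC ler_pM2r// ler_wpM2r// le_max lexx orbT//.
Qed.

(** Some centered cube has positive mass, the weight not being a.e. zero. A centered cube [K]
    containing both it and the given cube then has positive mass, and the A_1 condition on [K]
    bounds [mu] below a.e. by the positive constant [e]. *)
Lemma wmeasure_cube_gt0 a l : 0 < l -> 0 < m (cube a l).
Proof.
move=> l0; have [C C1 hC] := A1_ge_mean.
have [k k0] : exists k, 0 < m (centered_cube k).
  apply: contrapT => /forallNP h; have [[_ _ mu0] _] := muA1; apply: mu0.
  apply: ae_eq0_of_Rintegral_cube => [c r _||k]; [exact: mu_int|exact: mu_ge0|].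
  apply/eqP; rewrite eq_le.
  rewrite Rintegral_ge0 ?andbT//.
  by rewrite leNgt; apply/negP; exact: h.
have [j aj] := subset_centered_cube a l.
pose K : set 'rV[R]_n.+1 := centered_cube (maxn k j).
have sub i : (i <= maxn k j)%N -> centered_cube i `<=` K.
  move=> ik; apply: subset_cube => i'; rewrite !mxE.
  have : i.+1%:R <= (maxn k j).+1%:R :> R by rewrite ler_nat.
  lra.
have L0 : 0 < 2 * (maxn k j).+1%:R :> R by rewrite mulr_gt0.
have K0 : 0 < m K.
  apply: lt_le_trans k0 _; apply: ge0_subset_Rintegral => //.
  - exact: measurable_cube.
  - exact: measurable_cube.
  - exact/sub/leq_maxl.
  - exact: mu_int.
pose e := m K / (C * vol (2 * (maxn k j).+1%:R)).
have C0 : 0 < C := lt_le_trans ltr01 C1.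
have Cv0 : 0 < C * vol (2 * (maxn k j).+1%:R) by rewrite mulr_gt0// volume_gt0.
have e0 : 0 < e by rewrite divr_gt0.
apply: (@lt_le_trans _ _ (e * vol l)); first by rewrite mulr_gt0// volume_gt0.
rewrite -(Rintegral_cst_cube a e l0); apply: ae_ge0_le_Rintegral => //.
- exact: measurable_cube.
- exact: integrable_cst_cube.
- by move=> x _; exact: ltW.
- apply: filterS hC => x hx xQ; rewrite ler_pdivrMr// mulrC; apply: hx => //.
  by apply: (sub j); [exact: leq_maxr|exact: aj].
Qed.

(** Removing a half-size cube leaves the fraction $1 - h$ of the volume, with $h = 2^{-(n+1)}$.
    There [mu] is at least $\mu(Q)/(C|Q|)$ a.e., so the remainder carries at least $(1 - h)/C$ of
    the mass. *)
Lemma A1_reverse_doubling : exists2 g : R, 0 < g < 1 & forall a l c, 0 < l ->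
  cube c (l / 2) `<=` cube a l -> m (cube c (l / 2)) <= g * m (cube a l).
Proof.
have [C C1 hC] := A1_ge_mean; have C0 : 0 < C := lt_le_trans ltr01 C1.
pose h : R := 2^-1 ^+ n.+1.
have h0 : 0 < h by rewrite exprn_gt0// invr_gt0.
have h1 : h < 1 by rewrite exprn_ilt1 ?invr_ge0// invf_lt1// ltr1n.
exists (1 - (1 - h) / C).
  have : (1 - h) / C <= 1 - h by rewrite ler_pdivrMr// ler_peMr; lra.
  have : 0 < (1 - h) / C by rewrite divr_gt0//; lra.
  lra.
move=> a l c l0 sub.
have v0 := volume_gt0 l0; have m0 := wmeasure_cube_gt0 a l0.
have l20 : 0 < l / 2 by rewrite divr_gt0.
have vol2 : vol (l / 2) = h * vol l by rewrite /volume exprMn /h; ring.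
have mQ := @measurable_cube R n a l; have mP := @measurable_cube R n c (l / 2).
have mD := measurableD mQ mP.
pose e := m (cube a l) / (C * vol l).
have Cv0 : 0 < C * vol l by rewrite mulr_gt0.
have le_D : \int[leb]_(x in cube a l `\` cube c (l / 2)) e <=
    \int[leb]_(x in cube a l `\` cube c (l / 2)) mu x.
  apply: ae_ge0_le_Rintegral => //.
  - apply: integrableS (integrable_cst_cube a e l0) => //; exact: subDsetl.
  - apply: integrableS (mu_int a l) => //; exact: subDsetl.
  - by move=> x _; rewrite divr_ge0 ?ltW.
  - apply: filterS hC => x hx [xQ _].
    by rewrite ler_pdivrMr// mulrC; exact: hx.
move: le_D; rewrite !Rintegral_setD//; last exact: integrable_cst_cube.
rewrite !Rintegral_cst_cube// vol2.
have -> : e * vol l - e * (h * vol l) = (1 - h) / C * m (cube a l).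
  by rewrite /e; field; rewrite !gt_eqF.
by move=> le_D; rewrite mulrBl mul1r lerBrDr addrC -lerBrDr.
Qed.

(* Splitting a cube into its [2 ^ (n + 1)] halves improves the constant in the
   hypothesis by the factor [g `^ p], so that iterating drives it to [0]. *)
Lemma Rintegral_eq0_of_power (f : 'rV[R]_n.+1 -> R) (K p : R) a l :
  0 < l -> 0 < p ->
  (forall c r, 0 < r -> leb.-integrable (cube c r) (EFin \o f)) ->
  (forall x, 0 <= f x) ->
  (forall c (r : R), 0 < r -> cube c r `<=` cube a l ->
    \int[leb]_(x in cube c r) f x <= K * m (cube c r) `^ (1 + p)) ->
  \int[leb]_(x in cube a l) f x = 0.
Proof.
move=> l0 p0 fi f0 fK; have [g /andP[g0 g1] hg] := A1_reverse_doubling.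
pose q := g `^ p.
have q1 : q < 1.
  have : g `^ p < 1 `^ p by apply: gt0_ltr_powR => //; rewrite nnegrE ltW.
  by rewrite powR1.
have q0 : 0 <= q by exact: powR_ge0.
have m1p c r : 0 < r ->
    m (cube c r) `^ (1 + p) = m (cube c r) * m (cube c r) `^ p.
  move=> r0; have mr := wmeasure_cube_gt0 c r0.
  by rewrite powRD ?powRr1 ?(ltW mr)//; apply/implyP => _; rewrite gt_eqF.
(* [Num.max K 0] keeps the constant nonnegative, so that the remaining factors can be enlarged
   inside the product. *)
have step k : forall c (r : R), 0 < r -> cube c r `<=` cube a l ->
    \int[leb]_(x in cube c r) f x <=
      Num.max K 0 * q ^+ k * m (cube c r) `^ (1 + p).
  elim: k => [|k IH] c r r0 sub.
    rewrite expr0 mulr1; apply: le_trans (fK _ _ r0 sub) _.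
    by rewrite ler_wpM2r ?powR_ge0// le_max lexx.
  rewrite Rintegral_subcubes//.
  have r20 : 0 < r / 2 by rewrite divr_gt0.
  apply: (@le_trans _ _ (\sum_(s : {ffun 'I_n.+1 -> bool})
      Num.max K 0 * q ^+ k.+1 * m (cube c r) `^ p * m (subcube c r s)));
    last first.
    rewrite -mulr_sumr -Rintegral_subcubes// m1p// le_eqVlt; apply/orP; left.
    apply/eqP; ring.
  apply: ler_sum => s _; have ss := subcube_sub (s := s) (a := c) (ltW r0).
  apply: le_trans (IH _ _ r20 (subset_trans ss sub)) _.
  have ms : 0 < m (subcube c r s) by exact: wmeasure_cube_gt0.
  have mr := wmeasure_cube_gt0 c r0.
  have : m (subcube c r s) <= g * m (cube c r) by exact: hg.
  rewrite (_ : m (subcube c r s) `^ (1 + p) =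
    m (subcube c r s) * m (subcube c r s) `^ p); last exact: m1p.
  move: (m (subcube c r s)) (m (cube c r)) ms mr => S W S0 W0 SW.
  have SWp : S `^ p <= q * W `^ p.
    rewrite /q -powRM ?(ltW g0) ?(ltW W0)//; apply: ge0_ler_powR => //.
    - exact: ltW.
    - by rewrite nnegrE ltW.
    - by rewrite nnegrE mulr_ge0 ?ltW.
  rewrite exprSr (_ : _ * S = Num.max K 0 * q ^+ k * (S * (q * W `^ p)));
    last by ring.
  rewrite ler_wpM2l ?mulr_ge0 ?exprn_ge0 ?le_max ?lexx ?orbT//.
  by rewrite ler_wpM2l// ltW.
apply/eqP; rewrite eq_le Rintegral_ge0// andbT.
have : (fun k => Num.max K 0 * q ^+ k * m (cube a l) `^ (1 + p)) @ \oo -->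
    Num.max K 0 * 0 * m (cube a l) `^ (1 + p).
  apply: cvgM; last exact: cvg_cst.
  apply: cvgM; first exact: cvg_cst.
  by apply: cvg_expr; rewrite ger0_norm.
rewrite mulr0 mul0r => lim0; apply: (cvgr_to_ge lim0).
by apply: nearW => k; exact: step.
Qed.

End A1_weights.

(** A crude substitute for Hoelder's inequality. The last term is $g\,(g/(\lambda w))^{s-1}$, which
    is at least $g$ as soon as $g > \lambda w$; otherwise the first term suffices. *)
Lemma le_powR_split (R : realType) (g lam w s : R) :
  0 <= g -> 0 < lam -> 0 < w -> 1 <= s ->
  g <= lam * w + lam `^ (1 - s) * (g `^ s * w `^ (1 - s)).
Proof.
move=> g0 lam0 w0 s1; have lw0 : 0 < lam * w by rewrite mulr_gt0.
have [glw|glw] := leP g (lam * w).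
  by apply: le_trans glw _; rewrite lerDl !mulr_ge0 ?powR_ge0.
have {}g0 : 0 < g := lt_trans lw0 glw.
rewrite mulrCA -powRM ?(ltW lam0) ?(ltW w0)// -[leLHS]add0r.
apply: lerD; first exact: ltW.
rewrite -[1 - s]opprB powRN ler_pdivlMr ?powR_gt0//.
rewrite -[X in X * _](powRr1 (ltW g0)).
have -> : g `^ s = g `^ 1 * g `^ (s - 1).
  by rewrite -powRD; [congr powR; lra|apply/implyP => _; rewrite gt_eqF].
rewrite ler_wpM2l ?powR_ge0//; apply: ge0_ler_powR.
- by rewrite subr_ge0.
- by rewrite nnegrE ltW.
- by rewrite nnegrE ltW.
- exact: ltW.
Qed.

(** * The Lipschitz condition and the oscillation of [b] in terms of real integrals *)

Section Lipschitz_and_oscillation.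
Context {R : realType} {n : nat}.
Implicit Types (a c x : 'rV[R]_n.+1) (l : R).
Variables (mu b : 'rV[R]_n.+1 -> R) (beta : R).
Hypotheses (muA1 : A1 mu) (b_loc : locally_integrable_Rn b) (beta0 : 0 < beta).

Local Notation leb := (@lebesgue_measure_Rn R n).
Local Notation u := (@unit_volume R n).
Local Notation vol := (@volume R n).
Local Notation m Q := (\int[leb]_(x in Q) mu x).
Local Notation p := (beta / n.+1%:R).

Let mu_ge0 x : 0 <= mu x. Proof. by have [[]] := muA1. Qed.

Let mu_loc : locally_integrable_Rn mu. Proof. by have [[]] := muA1. Qed.

(** A cube of side 1 with corner [x] has positive mass, and the A_1 condition bounds this mass by a
    positive multiple of [mu x]. *)
Let mu_gt0 : {ae leb, forall x, 0 < mu x}.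
Proof.
have [C C1 hC] := A1_ge_mean muA1; apply: filterS hC => x hx.
have := hx x 1 ltr01 (corner_cube x ler01).
move/(lt_le_trans (wmeasure_cube_gt0 muA1 x ltr01)).
by rewrite pmulr_rgt0// mulr_gt0 ?(lt_le_trans _ C1)// (volume_gt0 muA1).
Qed.

Let u_gt0 : 0 < u. Proof. exact: A1_unit_volume_gt0 muA1. Qed.

Let b_int a l : leb.-integrable (cube a l) (EFin \o b).
Proof. exact: locally_integrable_cube. Qed.

Let absb_int a l : leb.-integrable (cube a l) (EFin \o (fun x => `|b x|)).
Proof. exact: integrable_norm. Qed.

Let p_gt0 : 0 < p. Proof. by rewrite divr_gt0. Qed.

Let powR1p (W : R) : 0 < W -> W `^ (1 + p) = W * W `^ p.
Proof.
move=> W0; rewrite powRD ?powRr1 ?(ltW W0)//.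
by apply/implyP => _; rewrite gt_eqF.
Qed.

Let dist_int a l k :
  0 < l -> leb.-integrable (cube a l) (EFin \o (fun x => `|b x - k|)).
Proof.
move=> l0; apply: (@integrable_norm _ _ _ _ _ (fun x => b x - k)).
apply: (@integrableB _ _ _ _ _ _ (EFin \o b) (EFin \o cst k)) => //.
- exact: measurable_cube.
- exact: integrable_cst_cube.
Qed.

Lemma Lip_norm_ltyP : (Lip_norm beta mu b < +oo)%E <->
  exists K : R, forall a l, 0 < l ->
    \int[leb]_(x in cube a l) `|b x - cube_mean b (cube a l)| <=
      K * m (cube a l) `^ (1 + p).
Proof.
have E a l : 0 < l -> ((wmeasure mu (cube a l) `^ (1 + p))^-1 *
    \int[leb]_(x in cube a l) `|b x - cube_mean b (cube a l)|%:E)%E =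
    (\int[leb]_(x in cube a l) `|b x - cube_mean b (cube a l)| /
      m (cube a l) `^ (1 + p))%:E.
  move=> l0; have W0 := wmeasure_cube_gt0 muA1 a l0.
  rewrite wmeasure_cubeE// poweR_EFin inver gt_eqF ?powR_gt0//.
  rewrite EFin_Rintegral; [|exact: measurable_cube|exact: dist_int].
  by rewrite -EFinM mulrC.
split=> [Ly|[K hK]].
  exists (fine (Lip_norm beta mu b)) => a l l0.
  have W0 := wmeasure_cube_gt0 muA1 a l0.
  have : ((\int[leb]_(x in cube a l) `|b x - cube_mean b (cube a l)| /
      m (cube a l) `^ (1 + p))%:E <= Lip_norm beta mu b)%E.
    rewrite -E//; apply: ereal_sup_ubound; exists (cube a l) => //.
    exact: cube_in_cubes.
  move=> le_L; rewrite -ler_pdivrMr ?powR_gt0// -lee_fin fineK//.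
  rewrite ge0_fin_numE//; apply: le_trans le_L.
  by rewrite lee_fin divr_ge0 ?powR_ge0// Rintegral_ge0.
apply: (@le_lt_trans _ _ K%:E); last exact: ltry.
apply: ge_ereal_sup => _ [_ [a [l l0 ->]] <-].
rewrite [X in (X <= _)%E]E// lee_fin ler_pdivrMr ?hK// powR_gt0//.
exact: wmeasure_cube_gt0.
Qed.

(** * From the oscillation condition to nonnegativity and the Lipschitz condition *)

Let avg a l : R := (\int[leb]_(x in cube a l) `|b x|) / vol l.

Let excess a l x : R := Num.max 0 (avg a l - b x).

Let excess_ge0 a l x : 0 <= excess a l x.
Proof. by rewrite le_max lexx. Qed.

Let local_maximal_avg a l x : 0 < l -> cube a l x ->
  ((avg a l)%:E <= local_maximal (cube a l) b x)%E.
Proof.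
move=> l0 xQ; apply: ereal_sup_ubound; exists (cube a l).
  by split => //; exact: cube_in_cubes.
rewrite lebesgue_cube// inver gt_eqF ?(volume_gt0 muA1)// muleC.
by rewrite EFin_Rintegral//; exact: measurable_cube.
Qed.

Let excess_le a l x : 0 < l -> cube a l x ->
  ((excess a l x)%:E <= `|(b x)%:E - local_maximal (cube a l) b x|)%E.
Proof.
(* If the maximal function is infinite at [x], so is the right-hand side; the value [-oo] is
   excluded by the lower bound [avg a l]. *)
move=> l0 /(local_maximal_avg l0); case: local_maximal => [r|_|//].
  rewrite !lee_fin /excess ge_max normr_ge0/= distrC => h.
  by apply: le_trans (ler_norm _); rewrite lerD2r.
by rewrite leey.
Qed.

Let measurable_excess a l : measurable_fun setT (excess a l).
Proof.
apply: measurable_maxr; first exact: measurable_cst.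
by apply: measurable_funB; [exact: measurable_cst|exact: b_loc.1].
Qed.

Let excess_int a l : 0 < l -> leb.-integrable (cube a l) (EFin \o excess a l).
Proof.
move=> l0; have mQ := @measurable_cube R n a l.
apply: (@le_integrable _ _ _ leb _ mQ _ (EFin \o (fun x => `|b x - avg a l|))).
- by apply/measurable_EFinP; apply: measurable_funTS.
- move=> x _ /=; rewrite lee_fin normr_id ger0_norm// /excess ge_max normr_ge0/=.
  by rewrite distrC ler_norm.
- exact: dist_int.
Qed.

(** Undoes the root and the normalizations in the oscillation condition, and passes to the excess,
    whose measurability is known. *)
Let oscillation_power_bound s :
  1 <= s -> maximal_oscillation_bounded beta mu b s ->
  exists2 C : R, 0 < C & forall a l, 0 < l ->
  (\int[leb]_(x in cube a l) ((excess a l x `^ s * mu x `^ (1 - s))%:E) <=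
    (m (cube a l) * (C * m (cube a l) `^ p) `^ s)%:E)%E.
Proof.
move=> s1 [C hC]; exists (Num.max 1 C); first by rewrite lt_max ltr01.
have s0 : 0 < s := lt_le_trans ltr01 s1.
move=> a l l0; have W0 := wmeasure_cube_gt0 muA1 a l0.
set W := m (cube a l) in W0 *.
pose F x := (`|(b x)%:E - local_maximal (cube a l) b x| `^ s *
  (mu x `^ (1 - s))%:E)%E.
have F0 x : (0 <= F x)%E by rewrite mule_ge0// ?poweR_ge0// lee_fin powR_ge0.
have {}hC : ((W `^ p)^-1%:E * (W^-1%:E * \int[leb]_(x in cube a l) F x) `^ s^-1 <=
    (Num.max 1 C)%:E)%E.
  apply: (@le_trans _ _ C%:E); last by rewrite lee_fin le_max lexx orbT.
  apply: le_trans hC; apply: ereal_sup_ubound.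
  exists (cube a l); first exact: cube_in_cubes.
  by rewrite wmeasure_cubeE// poweR_EFin !inver !gt_eqF ?powR_gt0.
apply: (@le_trans _ _ (\int[leb]_(x in cube a l) F x)%E).
  apply: ge0_le_lower_integral => x xQ.
    by rewrite lee_fin mulr_ge0 ?powR_ge0.
  rewrite EFinM /F lee_wpmul2r ?lee_fin ?powR_ge0// -poweR_EFin.
  apply: (gt0_ler_poweR (ltW s0)); last exact: excess_le.
  - by rewrite in_itv/= leey andbT lee_fin.
  - by rewrite in_itv/= leey andbT.
have : (0 <= \int[leb]_(x in cube a l) F x)%E by apply: integral_ge0.
have Cp0 : 0 < Num.max 1 C * W `^ p by rewrite mulr_gt0 ?powR_gt0// lt_max ltr01.
case: (\int[leb]_(x in cube a l) F x)%E hC => [i| |//].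
  rewrite -[(_ * i%:E)%E]EFinM poweR_EFin -EFinM !lee_fin => hC i0.
  rewrite ler_pdivrMl ?powR_gt0// [leRHS]mulrC in hC.
  rewrite -ler_pdivrMl//.
  have W1i : 0 <= W^-1 * i by rewrite mulr_ge0 ?invr_ge0 ?(ltW W0).
  have : ((W^-1 * i) `^ s^-1) `^ s <= (Num.max 1 C * W `^ p) `^ s.
    apply: (ge0_ler_powR (ltW s0)) hC; first by rewrite nnegrE powR_ge0.
    by rewrite nnegrE ltW.
  by rewrite -powRrM mulVf ?(lt0r_neq0 s0)// powRr1.
(* An infinite integral would contradict the finite bound. *)
rewrite gt0_muley ?lte_fin ?invr_gt0// poweRyr ?invr_eq0 ?gt_eqF//.
by rewrite gt0_muley ?lte_fin ?invr_gt0 ?powR_gt0.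
Qed.

Let excess_bound s : 1 <= s -> maximal_oscillation_bounded beta mu b s ->
  exists K : R, forall a l, 0 < l ->
    \int[leb]_(x in cube a l) excess a l x <= K * m (cube a l) `^ (1 + p).
Proof.
move=> s1 /(oscillation_power_bound s1)[C C0 hC].
exists (2 * C) => a l l0; have W0 := wmeasure_cube_gt0 muA1 a l0.
have {}hC := hC a l l0.
set W := m (cube a l) in W0 hC *.
(* With this [lam] both terms of [le_powR_split] integrate to at most [lam * W], whence the constant
   [2 * C]. *)
pose lam := C * W `^ p; have lam0 : 0 < lam by rewrite mulr_gt0// powR_gt0.
have mQ := @measurable_cube R n a l.
have mF : measurable_fun (cube a l)
    (fun x => (excess a l x `^ s * mu x `^ (1 - s))%:E).
  apply/measurable_EFinP; apply: measurable_funTS; apply: measurable_funM.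
    exact: (measurableT_comp (measurable_powR s)).
  by apply: (measurableT_comp (measurable_powR (1 - s))); exact: mu_loc.1.
have mM : measurable_fun (cube a l) (fun x => (mu x)%:E).
  by apply/measurable_EFinP; apply: measurable_funTS; exact: mu_loc.1.
rewrite -lee_fin -EFin_Rintegral//; last exact: excess_int.
apply: (@le_trans _ _ (\int[leb]_(x in cube a l) (lam%:E * (mu x)%:E +
    (lam `^ (1 - s))%:E * (excess a l x `^ s * mu x `^ (1 - s))%:E))%E).
  apply: ae_ge0_le_lower_integral.
  - exact: mQ.
  - by apply: emeasurable_funD; apply: measurable_funeM.
  - by move=> x _; rewrite lee_fin.
  - move=> x _; rewrite -!EFinM -EFinD lee_fin.
    apply: addr_ge0; first by rewrite mulr_ge0 ?(ltW lam0).
    by rewrite mulr_ge0 ?powR_ge0// mulr_ge0 ?powR_ge0.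
  - apply: filterS mu_gt0 => x mux _.
    by rewrite -!EFinM -EFinD lee_fin; exact: le_powR_split.
rewrite ge0_integralD;
  [|exact: mQ| |exact: measurable_funeM| |exact: measurable_funeM].
- rewrite ge0_integralZl_EFin;
    [|exact: mQ|by move=> x _; rewrite lee_fin|exact: mM|exact: ltW].
  rewrite ge0_integralZl_EFin; [|exact: mQ| |exact: mF|exact: powR_ge0];
    last first.
    by move=> x _; rewrite lee_fin mulr_ge0 ?powR_ge0.
  rewrite -/(wmeasure mu (cube a l)) wmeasure_cubeE// -/W.
  apply: (@le_trans _ _ (lam%:E * W%:E +
    (lam `^ (1 - s))%:E * (W * lam `^ s)%:E)%E).
    by apply: leeD2l; apply: lee_wpmul2l => //; rewrite lee_fin powR_ge0.
  rewrite -!EFinM -EFinD lee_fin mulrCA -powRD; last first.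
    by apply/implyP => _; rewrite gt_eqF.
  rewrite subrK powRr1 ?(ltW lam0)// powR1p// /lam le_eqVlt; apply/orP; left.
  by apply/eqP; ring.
- by move=> x _; rewrite -EFinM lee_fin mulr_ge0 ?(ltW lam0).
- move=> x _; rewrite -EFinM lee_fin mulr_ge0 ?powR_ge0//.
  by rewrite mulr_ge0 ?powR_ge0.
Qed.

Let Rintegral_avg a l : 0 < l ->
  \int[leb]_(x in cube a l) avg a l = \int[leb]_(x in cube a l) `|b x|.
Proof.
by move=> l0; rewrite Rintegral_cst_cube// divfK// gt_eqF// (volume_gt0 muA1).
Qed.

Lemma oscillation_bounded_ge0 s : 1 <= s ->
  maximal_oscillation_bounded beta mu b s -> {ae leb, forall x, 0 <= b x}.
Proof.
move=> s1 /(excess_bound s1)[K hK].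
pose f x := Num.max 0 (- b x).
have f0 x : 0 <= f x by rewrite le_max lexx.
have mf : measurable_fun setT f.
  apply: measurable_maxr; first exact: measurable_cst.
  by apply: measurable_funN; exact: b_loc.1.
have fb x : `|f x| <= `|b x|.
  by rewrite ger0_norm// ge_max normr_ge0/= -normrN ler_norm.
have fi c r : leb.-integrable (cube c r) (EFin \o f).
  have mQ := @measurable_cube R n c r.
  apply: (@le_integrable _ _ _ leb _ mQ _ (EFin \o b)) => //.
  - by apply/measurable_EFinP; apply: measurable_funTS.
  - by move=> x _; rewrite /= lee_fin.
have : {ae leb, forall x, f x = 0}.
  apply: ae_eq0_of_Rintegral_cube => // k.
  apply: (Rintegral_eq0_of_power muA1 (K := K) (p := p)) => // c r r0 _.
  apply: le_trans (hK c r r0).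
  have mQ := @measurable_cube R n c r.
  apply: (@le_trans _ _ (\int[leb]_(x in cube c r) (`|b x| - b x) / 2)).
    rewrite -RintegralZr//; last first.
      by apply: (@integrableB _ _ _ _ _ _ (EFin \o (fun x => `|b x|)) (EFin \o b)).
    apply: le_Rintegral => //.
    - apply: (@integrableZr _ _ _ _ _ mQ 2^-1 (fun x => (`|b x| - b x)%:E)).
      by apply: (@integrableB _ _ _ _ _ _ (EFin \o (fun x => `|b x|)) (EFin \o b)).
    - move=> x _; rewrite /f ge_max; have := ler_norm (b x).
      by have := ler_norm (- b x); rewrite normrN; lra.
  (* [|b|] has the same integral over the cube as its constant mean [avg c r]. *)
  have : \int[leb]_(x in cube c r) (`|b x| - b x) <=
      \int[leb]_(x in cube c r) excess c r x.
    rewrite RintegralB// -Rintegral_avg// -RintegralB//;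
      last exact: integrable_cst_cube.
    apply: le_Rintegral => //.
    - apply: (@integrableB _ _ _ _ _ _ (EFin \o cst (avg c r)) (EFin \o b)) => //.
      exact: integrable_cst_cube.
    - exact: excess_int.
    - by move=> x _; rewrite /excess le_max lexx orbT.
  have : 0 <= \int[leb]_(x in cube c r) excess c r x by exact: Rintegral_ge0.
  lra.
apply: filterS => x fx; rewrite -oppr_le0 -fx le_max lexx orbT//.
Qed.

(** With [k] the mean of [b], $|b - k| = 2(k - b)^+ - (k - b)$. The last term integrates to 0, and
    $(k - b)^+$ is at most the excess because [k] is at most the mean of $|b|$. *)
Lemma oscillation_bounded_Lip s : 1 <= s ->
  maximal_oscillation_bounded beta mu b s -> Lip beta mu b.
Proof.
move=> s1 /(excess_bound s1)[K hK]; split => //; apply/Lip_norm_ltyP.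
exists (2 * K) => a l l0; have mQ := @measurable_cube R n a l.
set k := cube_mean b (cube a l).
have kA : k <= avg a l.
  rewrite /avg ler_pdivlMr ?(volume_gt0 muA1)// mulrC -cube_meanE//.
  by apply: le_Rintegral => // x _; exact: ler_norm.
have ik : leb.-integrable (cube a l) (EFin \o (fun x => k - b x)).
  apply: (@integrableB _ _ _ _ _ _ (EFin \o cst k) (EFin \o b)) => //.
  exact: integrable_cst_cube.
have ie := excess_int a l0.
have i2e : leb.-integrable (cube a l) (EFin \o (fun x => 2 * excess a l x)).
  exact: (integrableZl mQ 2 ie).
apply: (@le_trans _ _ (\int[leb]_(x in cube a l) (2 * excess a l x - (k - b x)))).
  apply: le_Rintegral => //; first exact: dist_int.
    exact: (integrableB mQ i2e ik).
  move=> x _; have : k - b x <= excess a l x.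
    by rewrite /excess le_max lerD2r kA orbT.
  move: (excess_ge0 a l x); move: (excess a l x) (b x) => e y.
  have [h|h] := lerP 0 (y - k); [rewrite ger0_norm//|rewrite ltr0_norm//]; lra.
rewrite RintegralB// RintegralZl// RintegralB//; last exact: integrable_cst_cube.
rewrite Rintegral_cst_cube// (mulrC k) -cube_meanE// subrr subr0 -mulrA.
by rewrite ler_wpM2l// hK.
Qed.

(** * From the Lipschitz condition and nonnegativity to the oscillation condition *)

Section Lipschitz_estimates.
Hypothesis b_Lip : (Lip_norm beta mu b < +oo)%E.

Let cube_mean_diff : exists2 D : R, 0 <= D &
  {ae leb, forall x, forall a l a' l', 0 < l' -> cube a' l' `<=` cube a l ->
    cube a' l' x ->
    `|cube_mean b (cube a' l') - cube_mean b (cube a l)| <=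
      D * mu x * m (cube a l) `^ p}.
Proof.
have [L hL] := Lip_norm_ltyP.1 b_Lip.
have [C C1 hC] := A1_ge_mean muA1.
have [g /andP[g0 g1] hg] := A1_reverse_doubling muA1.
have C0 : 0 < C := lt_le_trans ltr01 C1.
have L0 : 0 <= L.
  have W0 := wmeasure_cube_gt0 muA1 0 (@ltr01 R).
  rewrite -(pmulr_lge0 _ (powR_gt0 (1 + p) W0)).
  by apply: le_trans (hL 0 1 ltr01); exact: Rintegral_ge0.
have gp1 : g `^ p < 1.
  have : g `^ p < 1 `^ p by apply: gt0_ltr_powR => //; rewrite nnegrE ltW.
  by rewrite powR1.
(* [B] is the cost of one step of the chain and [D] the sum of the geometric series of ratio $g^p$.
   The identity $D g^p + B = D$ closes the induction below. *)
pose B := 2 ^+ n.+1 * C * L.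
have B0 : 0 <= B by rewrite mulr_ge0// mulr_ge0// ?exprn_ge0// ltW.
pose D := B / (1 - g `^ p).
have D0 : 0 <= D by rewrite divr_ge0// subr_ge0 ltW.
have BD : B = D * (1 - g `^ p) by rewrite divfK// gt_eqF// subr_gt0.
exists D => //; apply: filterS hC => x hx.
(* For sides comparable up to a factor 2, $|b_{Q'} - b_Q| \le |Q'|^{-1}\int_Q |b - b_Q| \le 2^{n+1}
   L\,\mu(Q)^{1+p}/|Q|$, and the A_1 condition bounds $\mu(Q)/|Q|$ by $C\mu(x)$. *)
have base a l a' l' : 0 < l -> 0 < l' -> l <= 2 * l' ->
    cube a' l' `<=` cube a l -> cube a' l' x ->
    `|cube_mean b (cube a' l') - cube_mean b (cube a l)| <=
      B * mu x * m (cube a l) `^ p.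
  move=> l0 l'0 ll' sub xQ'; set k := cube_mean b (cube a l).
  have mQ := @measurable_cube R n a l; have mQ' := @measurable_cube R n a' l'.
  have W0 := wmeasure_cube_gt0 muA1 a l0.
  have v'0 := volume_gt0 muA1 l'0.
  have vv' : vol l <= 2 ^+ n.+1 * vol l'.
    rewrite /volume mulrA -exprMn ler_pM2r// lerXn2r// nnegrE ?mulr_ge0 ?ltW//.
  have ik : leb.-integrable (cube a' l') (EFin \o (fun y => b y - k)).
    apply: (@integrableB _ _ _ _ _ _ (EFin \o b) (EFin \o cst k)) => //.
    exact: integrable_cst_cube.
  have -> : cube_mean b (cube a' l') - k =
      (vol l')^-1 * \int[leb]_(y in cube a' l') (b y - k).
    rewrite RintegralB//; last exact: integrable_cst_cube.
    rewrite cube_meanE// Rintegral_cst_cube// mulrC mulrBl mulfK ?gt_eqF//.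
    by rewrite mulrAC mulfV ?gt_eqF// mul1r.
  rewrite normrM ger0_norm ?invr_ge0 ?(ltW v'0)// ler_pdivrMl//.
  apply: (le_trans (le_normr_Rintegral _ _)) => //.
  apply: (@le_trans _ _ (\int[leb]_(y in cube a l) `|b y - k|)).
    by apply: ge0_subset_Rintegral => //; exact: dist_int.
  apply: (le_trans (hL a l l0)).
  have := hx a l l0 (sub _ xQ').
  rewrite powR1p//; move: (m (cube a l)) W0 => W W0 Wx.
  rewrite (_ : vol l' * _ = L * (C * (2 ^+ n.+1 * vol l') * mu x * W `^ p));
    last first.
    by rewrite /B; ring.
  rewrite ler_wpM2l// ler_wpM2r ?powR_ge0//; apply: (le_trans Wx).
  by rewrite ler_wpM2r// ler_wpM2l// ltW.
have BDx W : B * mu x * W `^ p <= D * mu x * W `^ p.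
  rewrite ler_wpM2r ?powR_ge0// ler_wpM2r// BD ler_piMr//.
  by rewrite gerBl powR_ge0.
(* Induction on the number of halvings: a cube of side [l / 2] is inserted between the two, the
   induction hypothesis handles the inner pair and [base] the outer one, and reverse doubling
   supplies the factor $g^p$. *)
have chain k : forall a l a' l', 0 < l -> 0 < l' -> l <= 2 ^+ k * l' ->
    cube a' l' `<=` cube a l -> cube a' l' x ->
    `|cube_mean b (cube a' l') - cube_mean b (cube a l)| <=
      D * mu x * m (cube a l) `^ p.
  elim: k => [|k IH] a l a' l' l0 l'0 ll' sub xQ'.
    apply: le_trans (BDx _); apply: base => //.
    move: ll'; rewrite expr0 mul1r => /le_trans; apply.
    by rewrite ler_peMl ?ltW// ltr1n.
  have [l2l'|/ltW l'2l] := leP l (2 * l').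
    by apply: le_trans (BDx _); exact: base.
  have [c [sub' sub'']] := cube_between l'0 l'2l sub.
  have l20 : 0 < l / 2 by rewrite divr_gt0.
  have W'0 := wmeasure_cube_gt0 muA1 c l20.
  have W0 := wmeasure_cube_gt0 muA1 a l0.
  have le_l2 : l / 2 <= 2 ^+ k * l' by rewrite ler_pdivrMr// mulrAC -exprSr.
  have h1 := IH _ _ _ _ l20 l'0 le_l2 sub' xQ'.
  have l2l : l <= 2 * (l / 2) by rewrite mulrC divfK.
  have h2 := base _ _ _ _ l0 l20 l2l sub'' (sub' _ xQ').
  have W'W := hg _ _ _ l0 sub''.
  apply: (le_trans (ler_distD (cube_mean b (cube c (l / 2))) _ _)).
  apply: (le_trans (lerD h1 h2)).
  move: (m (cube a l)) (m (cube c (l / 2))) W0 W'0 W'W => W W' W0 W'0 W'W.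
  have W'Wp : W' `^ p <= g `^ p * W `^ p.
    rewrite -powRM ?(ltW g0) ?(ltW W0)//; apply: ge0_ler_powR => //.
    - exact: ltW.
    - by rewrite nnegrE ltW.
    - by rewrite nnegrE mulr_ge0 ?ltW.
  apply: (@le_trans _ _ (D * mu x * (g `^ p * W `^ p) + B * mu x * W `^ p)).
    by rewrite lerD2r ler_wpM2l// mulr_ge0.
  by rewrite BD le_eqVlt; apply/orP; left; apply/eqP; ring.
move=> a l a' l' l'0 sub xQ'.
have l0 : 0 < l.
  apply: (lt_le_trans l'0); have /cubeP xQ := sub _ xQ'.
  have l00 : 0 <= l by have := xQ 0; lra.
  exact: (subset_cube_side l00 (ltW l'0) sub).
(* This number [k] of halvings suffices, since $l/l' < k \le 2^k$. *)
apply: (chain (Num.truncn (l / l')).+1) => //.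
rewrite -ler_pdivrMr//; apply: (ltW (lt_le_trans (truncnS_gt _) _)).
by rewrite -natrX ler_nat ltnW// ltn_expl.
Qed.

Let dist_cube_mean : exists2 D : R, 0 <= D & forall a l, 0 < l ->
  {ae leb, forall x, cube a l x ->
    `|b x - cube_mean b (cube a l)| <= D * mu x * m (cube a l) `^ p}.
Proof.
have [D D0 hD] := cube_mean_diff; exists D => // a l l0.
have [L hL] := Lip_norm_ltyP.1 b_Lip.
set k := cube_mean b (cube a l); set w := m (cube a l) `^ p.
pose f x := Num.max 0 (`|b x - k| - D * mu x * w).
have f0 x : 0 <= f x by rewrite le_max lexx.
have mf : measurable_fun setT f.
  apply: measurable_maxr; first exact: measurable_cst.
  apply: measurable_funB.
    apply: measurableT_comp; first exact: normr_measurable.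
    by apply: measurable_funB; [exact: b_loc.1|exact: measurable_cst].
  apply: measurable_funM; last exact: measurable_cst.
  by apply: measurable_funM; [exact: measurable_cst|exact: mu_loc.1].
have fi c r : 0 < r -> leb.-integrable (cube c r) (EFin \o f).
  move=> r0; have mQ := @measurable_cube R n c r.
  apply: (@le_integrable _ _ _ leb _ mQ _ (EFin \o (fun x => `|b x - k|))).
  - by apply/measurable_EFinP; apply: measurable_funTS.
  - move=> x _; rewrite /= lee_fin normr_id ger0_norm// /f ge_max normr_ge0/=.
    by rewrite gerBl !mulr_ge0// powR_ge0.
  - exact: dist_int.
have mQ := @measurable_cube R n a l.
have : {ae leb, forall x, cube a l x -> f x = 0}.
  apply: Rintegral_eq0_ae; [exact: mQ|exact: fi|exact: f0|].
  apply: (Rintegral_eq0_of_power muA1 (K := L) (p := p)) => // c r r0 sub.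
  apply: (le_trans _ (hL c r r0)).
  apply: ae_ge0_le_Rintegral; [exact: measurable_cube|exact: fi|exact: dist_int| | |].
  - by move=> x _.
  - by move=> x _.
  (* On a subcube $P$, $|b - b_Q| \le |b - b_P| + |b_P - b_Q|$, and the last term is within the
     bound subtracted in [f]; hence $f \le |b - b_P|$ a.e. on $P$. *)
  - apply: filterS hD => x hx xP; rewrite /f ge_max normr_ge0/=.
    rewrite lerBlDr; apply: (le_trans (ler_distD (cube_mean b (cube c r)) _ _)).
    by rewrite lerD2l; exact: hx.
by apply: filterS => x fx /fx fx0; rewrite -subr_le0 -fx0 /f le_max lexx orbT.
Qed.

Lemma Lip_oscillation_bounded s : 1 <= s -> {ae leb, forall x, 0 <= b x} ->
  maximal_oscillation_bounded beta mu b s.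
Proof.
move=> s1 b_ge0; have s0 : 0 < s := lt_le_trans ltr01 s1.
have [D1 D10 hD1] := cube_mean_diff; have [D2 D20 hD2] := dist_cube_mean.
(* [D2] bounds the distance from [b] to its mean over the cube, [D1] that from this mean to the
   local maximal function. *)
pose D := D1 + D2; have D0 : 0 <= D by rewrite addr_ge0.
exists D; apply: ge_ereal_sup => _ [_ [a [l l0 ->]] <-].
rewrite -/(cube a l).
have W0 := wmeasure_cube_gt0 muA1 a l0; have mQ := @measurable_cube R n a l.
have bE c r : 0 < r -> ((leb (cube c r))^-1 *
    \int[leb]_(y in cube c r) `|b y|%:E)%E = (cube_mean b (cube c r))%:E.
  move=> r0; have mP := @measurable_cube R n c r.
  rewrite lebesgue_cube// inver gt_eqF ?(volume_gt0 muA1)//.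
  rewrite (_ : (\int[leb]_(y in cube c r) `|b y|%:E)%E =
      \int[leb]_(y in cube c r) (b y)%:E)%E.
    rewrite EFin_Rintegral// cube_meanE// -EFinM mulKf// gt_eqF//.
    exact: (volume_gt0 muA1).
  apply: ae_eq_integral; [exact: mP|exact: (measurable_int leb (absb_int c r))|
    exact: (measurable_int leb (b_int c r))|].
  by apply: filterS b_ge0 => y y0 _ /=; rewrite ger0_norm.
pose F x := (`|(b x)%:E - local_maximal (cube a l) b x| `^ s *
  (mu x `^ (1 - s))%:E)%E.
have F0 x : (0 <= F x)%E by rewrite mule_ge0// ?poweR_ge0// lee_fin powR_ge0.
rewrite -[X in (_ * X)%E]/((_ * \int[leb]_(x in cube a l) F x) `^ s^-1)%E.
rewrite wmeasure_cubeE//; set W := m (cube a l) in W0 *.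
have : (\int[leb]_(x in cube a l) F x <= ((D * W `^ p) `^ s * W)%:E)%E.
  have DW0 : 0 <= D * W `^ p by rewrite mulr_ge0// powR_ge0.
  apply: (@le_trans _ _ (\int[leb]_(x in cube a l)
      (((D * W `^ p) `^ s)%:E * (mu x)%:E))%E); last first.
    rewrite ge0_integralZl_EFin;
      [|exact: mQ|by move=> x _; rewrite lee_fin| |exact: powR_ge0].
      by rewrite EFinM -(wmeasure_cubeE muA1).
    exact: (measurable_int leb (locally_integrable_cube a l mu_loc)).
  apply: ae_ge0_le_lower_integral.
  - exact: mQ.
  - apply: measurable_funeM.
    exact: (measurable_int leb (locally_integrable_cube a l mu_loc)).
  - by move=> x _.
  - by move=> x _; rewrite -EFinM lee_fin mulr_ge0 ?powR_ge0.
  apply: filterS3 hD1 (hD2 a l l0) mu_gt0 => x h1 /[swap] mux h2 xQ.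
  set k := cube_mean b (cube a l) in h2; rewrite -/W in h2.
  (* The cube itself competes in the supremum, which gives the lower bound; [cube_mean_diff] bounds
     every competing mean from above. *)
  have [r Mr kr] : exists2 r, local_maximal (cube a l) b x = r%:E &
      k <= r <= k + D1 * mu x * W `^ p.
    have Mk : (k%:E <= local_maximal (cube a l) b x)%E.
      rewrite -bE//; apply: ereal_sup_ubound; exists (cube a l) => //.
      by split => //; exact: cube_in_cubes.
    have : (local_maximal (cube a l) b x <= (k + D1 * mu x * W `^ p)%:E)%E.
      apply: ge_ereal_sup => _ [_ [[c [r r0 ->]] xP sub] <-].
      rewrite [X in (X <= _)%E]bE// lee_fin -lerBlDl.
      by apply: (le_trans (ler_norm _)); exact: h1.
    case: local_maximal Mk => [r| |]//; rewrite !lee_fin => kr rk.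
    by exists r => //; rewrite kr rk.
  have {h2} h2 := h2 xQ.
  have br : `|b x - r| <= D * W `^ p * mu x.
    apply: (le_trans (ler_distD k _ _)).
    have : `|k - r| <= D1 * mu x * W `^ p.
      by rewrite distrC ger0_norm; move: kr => /andP[]; lra.
    by rewrite /D; move: h2; rewrite -/k; nra.
  rewrite /F Mr -EFinB abse_EFin poweR_EFin -!EFinM lee_fin.
  (* The powers $s$ and $1 - s$ of [mu x] combine to [mu x] itself, by positivity of the weight at
     [x]. *)
  apply: (@le_trans _ _ ((D * W `^ p * mu x) `^ s * mu x `^ (1 - s))).
    rewrite ler_wpM2r ?powR_ge0//; apply: ge0_ler_powR => //; first exact: ltW.
    by rewrite nnegrE mulr_ge0.
  rewrite powRM// -mulrA -powRD; last by apply/implyP => _; rewrite gt_eqF.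
  by rewrite addrC subrK powRr1.
have : (0 <= \int[leb]_(x in cube a l) F x)%E by apply: integral_ge0.
case: (\int[leb]_(x in cube a l) F x)%E => [i|//|//]; rewrite !lee_fin => i0 hi.
have DW0 : 0 <= D * W `^ p by rewrite mulr_ge0// powR_ge0.
rewrite poweR_EFin !inver !gt_eqF ?powR_gt0//.
rewrite -[(_ * i%:E)%E]EFinM poweR_EFin -EFinM lee_fin.
rewrite ler_pdivrMl ?powR_gt0// [leRHS]mulrC.
have W1i : 0 <= W^-1 * i by rewrite mulr_ge0 ?invr_ge0 ?(ltW W0).
rewrite -[leRHS](powRr1 DW0).
have -> : (D * W `^ p) `^ 1 = ((D * W `^ p) `^ s) `^ s^-1.
  by rewrite -powRrM mulfV// lt0r_neq0.
apply: ge0_ler_powR; rewrite ?nnegrE ?powR_ge0//.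
  by rewrite invr_ge0 ltW.
by rewrite ler_pdivrMl// mulrC.
Qed.

End Lipschitz_estimates.

End Lipschitz_and_oscillation.

Theorem corollary1p1 (R : realType) (n : nat) (beta : R)
    (b mu : 'rV[R]_n.+1 -> R) :
  0 < beta -> beta < 1 ->
  locally_integrable_Rn b ->
  A1 mu ->
  ((Lip beta mu b /\ {ae @lebesgue_measure_Rn R n, forall x, 0 <= b x}) <->
   (exists s : R, 1 <= s /\ maximal_oscillation_bounded beta mu b s)) /\
  ((exists s : R, 1 <= s /\ maximal_oscillation_bounded beta mu b s) <->
   (forall s : R, 1 <= s -> maximal_oscillation_bounded beta mu b s)).
Proof.
move=> beta0 beta1 b_loc muA1.
have h21 s : 1 <= s -> maximal_oscillation_bounded beta mu b s ->
    Lip beta mu b /\ {ae @lebesgue_measure_Rn R n, forall x, 0 <= b x}.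
  move=> s1 hs; split; first exact: oscillation_bounded_Lip hs.
  exact: oscillation_bounded_ge0 hs.
have h13 : Lip beta mu b /\ {ae @lebesgue_measure_Rn R n, forall x, 0 <= b x} ->
    forall s, 1 <= s -> maximal_oscillation_bounded beta mu b s.
  by move=> [[_ bL] b0] s s1; exact: Lip_oscillation_bounded.
split; split.
- by move=> /h13 h; exists 1; split => //; exact: h.
- by move=> [s [s1 hs]]; exact: h21 hs.
- by move=> [s [s1 hs]]; exact/h13/h21/hs.
- by move=> h; exists 1; split => //; exact: h.
Qed.
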